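(* Let $p\in\Delta_{m-1}$, $\theta>0$, and let $\{p^\nu\}_{\nu\in\mathbb N}\subset\Delta_{m-1}$, $\{\theta^\nu\}_{\nu\in\mathbb N}\subset(0,\infty)$ satisfy $p^\nu\to p$ and $\theta^\nu\to\theta$. For $(u,v,X)\in\mathbb R^m\times\mathbb R^{N_T}\times\mathbb R^n$ let $$f_3(u,v,X)=-\sum_{j=1}^m(p_j+u_j)\langle S_{T+1}(j),X_T(j^-)\rangle+\iota_{\mathcal X(v)}(X)+\tfrac12\theta\|u\|_2^2+\iota_{[0,\infty)^m}(p+u)+\iota_{(-\infty,0]^m}(u),$$ $$f_3^\nu(u,v,X)=-\sum_{j=1}^m(p_j^\nu+u_j)\langle S_{T+1}(j),X_T(j^-)\rangle+\iota_{\mathcal X(v)}(X)+\tfrac12\theta^\nu\|u\|_2^2+\iota_{[0,\infty)^m}(p^\nu+u)+\iota_{(-\infty,0]^m}(u).$$ Then $f_3^\nu$ epi-converges to $f_3$.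
   Context: Scenario tree. Let $T,k\ge 1$ be integers and consider a finite rooted tree with levels $0,1,\dots,T+1$ (the history tree of a finitely supported discrete-time environment process), in which every node at a level $\le T$ has at least one child. For $0\le t\le T$, $I_t$ is the set of nodes at level $t$ ($I_0$ consists of the root), $n_t=|I_t|$, $N_T=\sum_{t=0}^T n_t$, $n=(k+1)N_T$. The terminal nodes (level $T+1$) are labeled $1,\dots,m$. For a node $i$, $i^-$ is its parent and $i^+$ its set of children. The terminal nodes are partitioned into original scenarios $I$ and added critical scenarios $\tilde I$ (all nodes at levels $\le T$ belong to the original tree). Market. Asset prices are $S_t(i)=(S_t^0,S_t^1(i),\dots,S_t^k(i))\in(0,\infty)^{k+1}$ for each node $i$ at level $t$; asset $0$ is risk-free (its price depends only on $t$). For $j\in\tilde I$ and $1\le i\le k$, $S^i_{T+1}(j)=\kappa_j^iS^i_T(j^-)$ with $\kappa_j^i>0$. The original market is arbitrage-free (no self-financing strategy with zero initial wealth has terminal wealth that is nonnegative a.s. and positive with positive probability). The claim is $G_0>0$ and $G_t(i)<0$ for $i\in I_t$, $1\le t\le T$. Probabilities. $\Delta_{m-1}=\{p\in\mathbb R^m_+:\sum_jp_j=1\}$; $p_j$ is the probability of terminal node $j$, with $p_j=0$ for $j\in\tilde I$; $p^\nu$ may charge any scenario. Strategies and perturbed feasible sets. $X\in\mathbb R^n$ is a family $X_t(i)\in\mathbb R^{k+1}$, $i\in I_t$, $0\le t\le T$. A claim perturbation $v\in\mathbb R^{N_T}$ has one component $v_t(i)$ per node $i\in I_t$, $0\le t\le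 T$. $\mathcal X(v)$ is the set of all $X$ with $X_t(i)\ge0$ componentwise for all $i\in I_t$, $0\le t\le T$; $\langle S_0,X_0\rangle\le G_0+v_0$; and $\langle S_t(i),X_t(i)-X_{t-1}(i^-)\rangle\le G_t(i)+v_t(i)$ for all $i\in I_t$, $1\le t\le T$. $\iota_C$ is the indicator function ($0$ on $C$, $+\infty$ off $C$). Epi-convergence: $g^\nu:\mathbb R^N\to\overline{\mathbb R}$ epi-converges to $g$ if for every $x$: (1) $\liminf_\nu g^\nu(x^\nu)\ge g(x)$ for every $x^\nu\to x$; (2) there is $x^\nu\to x$ with $\limsup_\nu g^\nu(x^\nu)\le g(x)$. *)

(* Defs.v *)
From HB Require Import structures.
From mathcomp Require Import all_boot all_order all_algebra.
From mathcomp Require Import all_classical all_reals all_analysis.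

Set Implicit Arguments.
Unset Strict Implicit.
Unset Printing Implicit Defensive.

Import Order.TTheory GRing.Theory Num.Theory.
Import numFieldNormedType.Exports.

Local Open Scope classical_set_scope.
Local Open Scope ring_scope.

(* The t-th level of the tree is 'I_(nb_nodes t), so the terminal nodes are
   'I_m with m := nb_nodes T.+1. Levels above T.+1 are unconstrained: they carry
   no information (they may be taken empty). *)
Record scenario_tree (T : nat) := ScenarioTree {
  nb_nodes : nat -> nat;
  parent : forall t : nat, 'I_(nb_nodes t.+1) -> 'I_(nb_nodes t);
  nb_root : nb_nodes 0%N = 1%N;
  has_child : forall t : nat, (t <= T)%N ->
    forall i : 'I_(nb_nodes t), exists j : 'I_(nb_nodes t.+1), parent j = i
}.

Arguments parent {T} _ {t} _.

Definition node (T : nat) (H : scenario_tree T) (t : nat) : Type :=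
  'I_(nb_nodes H t).

Definition nb_terminal (T : nat) (H : scenario_tree T) : nat :=
  nb_nodes H T.+1.

(* N_T *)
Definition nb_inner (T : nat) (H : scenario_tree T) : nat :=
  (\sum_(t < T.+1) nb_nodes H t)%N.

Section Market.
Variables (R : realType) (T k : nat) (H : scenario_tree T).

Definition inner_prod (x y : 'rV[R]_k.+1) : R := \sum_(a < k.+1) x 0 a * y 0 a.

(* R^{N_T} and R^n, n = (k+1) N_T: one row per node of level <= T. *)
Definition claim : Type := 'cV[R]_(nb_inner H).
Definition strategy : Type := 'M[R]_(nb_inner H, k.+1).

Definition claim_at (v : claim) (t : 'I_T.+1) (i : node H t) : R :=
  submxcol v t i 0.

Definition strategy_at (X : strategy) (t : 'I_T.+1) (i : node H t) :
  'rV[R]_k.+1 := row i (submxcol X t).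

(* S t i 0 0 is the price of the risk-free asset; the price of the a-th risky
   asset, a : 'I_k, is S t i 0 (lift ord0 a). *)
Definition prices : Type := forall t : nat, node H t -> 'rV[R]_k.+1.

(* For s : 'I_T, the indices lift ord0 s and widen_ord (leqnSn T) s of 'I_T.+1
   have values s.+1 and s. *)
Definition rebalancing (X : strategy) (s : 'I_T) (i : node H s.+1) :
    'rV[R]_k.+1 :=
  strategy_at X (t := lift ord0 s) i -
  strategy_at X (t := widen_ord (leqnSn T) s) (parent H i).

Definition terminal_wealth (S : prices) (X : strategy) (j : node H T.+1) : R :=
  inner_prod (S T.+1 j) (strategy_at X (t := ord_max) (parent H j)).

(* Short positions are allowed here, contrary to [feasible] below. *)
Definition zero_cost_self_financing (S : prices) (X : strategy) : Prop :=
  (forall i : node H 0%N,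
      inner_prod (S 0%N i) (strategy_at X (t := ord0) i) = 0) /\
  (forall (s : 'I_T) (i : node H s.+1),
      inner_prod (S s.+1 i) (rebalancing X i) = 0).

Definition arbitrage_free (S : prices) (p : 'rV[R]_(nb_terminal H)) : Prop :=
  ~ exists X : strategy,
      [/\ zero_cost_self_financing S X,
          (forall j : node H T.+1, 0 < p 0 j -> 0 <= terminal_wealth S X j) &
          (exists j : node H T.+1, 0 < p 0 j /\ 0 < terminal_wealth S X j)].

Definition feasible (S : prices) (G v : claim) : set strategy :=
  [set X | [/\
    (forall (t : 'I_T.+1) (i : node H t) (a : 'I_k.+1),
        0 <= strategy_at X i 0 a),
    (forall i : node H 0%N,
        inner_prod (S 0%N i) (strategy_at X (t := ord0) i)
        <= claim_at G (t := ord0) i + claim_at v (t := ord0) i) &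
    (forall (s : 'I_T) (i : node H s.+1),
        inner_prod (S s.+1 i) (rebalancing X i)
        <= claim_at G (t := lift ord0 s) i + claim_at v (t := lift ord0 s) i)]].

End Market.

Definition simplex (R : realType) (m : nat) : set 'rV[R]_m :=
  [set p | (forall j, 0 <= p 0 j) /\ \sum_(j < m) p 0 j = 1].

(* The indicator function of convex analysis. *)
Definition iota_set (R : realType) (E : Type) (C : set E) (x : E) : \bar R :=
  if `[< C x >] then 0%E else +oo%E.

Definition f3 (R : realType) (T k : nat) (H : scenario_tree T)
    (S : prices R k H) (G : claim R H)
    (p : 'rV[R]_(nb_terminal H)) (theta : R)
    (x : 'rV[R]_(nb_terminal H) * 'cV[R]_(nb_inner H)
         * 'M[R]_(nb_inner H, k.+1)) : \bar R :=
  let: (u, v, X) := x in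
  ((- \sum_(j < nb_terminal H) (p 0%R j + u 0%R j) * terminal_wealth S X j)%:E
   + iota_set R (feasible S G v) X
   + (2^-1 * theta * \sum_(j < nb_terminal H) u 0%R j ^+ 2)%:E
   + iota_set R [set q : 'rV[R]_(nb_terminal H) | forall j, (0 <= q 0 j)%R]
       (p + u)%R
   + iota_set R [set q : 'rV[R]_(nb_terminal H) | forall j, (q 0 j <= 0)%R]
       u)%E.

Definition epi_converges (R : realType) (E : normedModType R)
    (g_ : nat -> E -> \bar R) (g : E -> \bar R) : Prop :=
  forall x : E,
    (forall x_ : nat -> E, x_ nu @[nu --> \oo] --> x ->
       (g x <= limn_einf (fun nu => g_ nu (x_ nu)))%E) /\
    (exists x_ : nat -> E, x_ nu @[nu --> \oo] --> x /\
       (limn_esup (fun nu => g_ nu (x_ nu)) <= g x)%E).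

(* Main.v *)
(* Write the objective as a finite function plus the indicator of its domain,
   both seen as depending jointly on the point (p, theta, (u, v, X)). The finite
   part is jointly continuous and the domain is closed, so the sum is jointly
   lower semicontinuous, which is the liminf inequality. For the recovery
   sequence, keep v and X and replace u by u^nu = max(u, -p^nu): it is nonpositive,
   p^nu + u^nu >= 0, and u^nu --> max(u, -p) = u because p + u >= 0. *)
Require Import Defs.
From HB Require Import structures.
From mathcomp Require Import all_boot all_order all_algebra.
From mathcomp Require Import lra.
From mathcomp Require Import all_classical all_reals all_analysis.
Set Implicit Arguments.
Unset Strict Implicit.
Unset Printing Implicit Defensive.
Import Order.TTheory GRing.Theory Num.Theory.
Import numFieldNormedType.Exports.
Local Open Scope classical_set_scope.
Local Open Scope ring_scope.

(** * Lower limits and closed sets *)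

Lemma le_limn_einf (R : realType) (u v : (\bar R)^nat) :
  (\forall n \near \oo, (u n <= v n)%E) -> (limn_einf u <= limn_einf v)%E.
Proof.
move=> uv; rewrite [limn_einf u]limf_einfE [limn_einf v]limf_einfE.
apply: ge_ereal_sup => _ [V FV <-].
(* The lower limit is a supremum of infima over sets of the filter. Shrinking [V] to the indices
   where [u n <= v n] stays in the filter, and there the infimum of [v] is at least that of [u] over
   [V]. *)
apply: le_trans (ereal_sup_ubound _); last first.
  by exists (V `&` [set n | (u n <= v n)%E]) => //; exact: filterI.
apply: le_ereal_inf_tmp => _ [n [Vn /= uvn] <-].
by apply: le_trans uvn; apply: ereal_inf_lbound; exists n.
Qed.

Lemma closed_forall (E : topologicalType) (I : Type) (A : I -> set E) :
  (forall i, closed (A i)) -> closed [set x | forall i, A i x].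
Proof.
move=> Acl; rewrite (_ : [set x | _] = \bigcap_(i in [set: I]) A i).
  by apply: closed_bigI => i _; exact: Acl.
by apply/seteqP; split => [x Ax i _|x Ax i]; exact: Ax.
Qed.

Lemma closed_le_continuous (R : realType) (E : topologicalType) (f g : E -> R) :
  continuous f -> continuous g -> closed [set x | f x <= g x].
Proof.
move=> cf cg; rewrite (_ : [set x | _] = (g \- f) @^-1` [set r | 0 <= r]).
  apply: preimage_closed (@closed_ge _ 0) => x _.
  by apply: cvgB; [exact: cg|exact: cf].
by apply/seteqP; split => x /=; rewrite subr_ge0.
Qed.

Lemma continuous_sum (R : realType) (E : topologicalType) (I : Type)
    (r : seq I) (f : I -> E -> R) :
  (forall i, continuous (f i)) -> continuous (fun x => \sum_(i <- r) f i x).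
Proof.
by move=> cf x; apply: cvg_big => [|i _]; [exact: add_continuous|exact: cf].
Qed.

(** At a point of [D] the indicator can only raise the values above [h (z_ nu)], which tend to
    [h z]. Outside [D], the complement is an open neighbourhood of [z], so the sequence ends up in
    it and its values are eventually [+oo]. *)
Lemma limn_einf_indicator (R : realType) (E : topologicalType) (h : E -> R)
    (D : set E) (z : E) (z_ : nat -> E) :
  continuous h -> closed D -> z_ nu @[nu --> \oo] --> z ->
  ((h z)%:E + iota_set R D z <=
   limn_einf (fun nu => (h (z_ nu))%:E + iota_set R D (z_ nu)))%E.
Proof.
move=> ch clD cz; have [Dz|nDz] := asboolP (D z).
  rewrite /iota_set asboolT // adde0.
  have ch_ : (h (z_ nu))%:E @[nu --> \oo] --> (h z)%:E.
    by apply: cvg_EFin; [exact: nearW|exact: (cvg_comp z_ h cz (ch z))].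
  rewrite -(cvg_limn_einf_sup ch_).1; apply: le_limn_einf; apply: nearW => nu.
  by case: asboolP; rewrite ?adde0 // addey // leey.
rewrite /iota_set asboolF // addey //.
rewrite -[leLHS](cvg_limn_einf_sup (@cvg_cst (\bar R) +oo%E nat \oo _)).1.
apply: le_limn_einf.
have nDz_ : \forall nu \near \oo, ~ D (z_ nu).
  apply: (cz (~` D)); apply: open_nbhs_nbhs; split => //.
  exact: closed_openC.
by apply: filterS nDz_ => nu nDnu; rewrite asboolF // addey.
Qed.

(** * Continuity of strategies and closedness of the budget constraints *)

Section Continuity.
Variables (R : realType) (T k : nat) (H : scenario_tree T).
Variables (S : prices R k H) (G : claim R H) (E : topologicalType).

Lemma strategy_atE (X : strategy R k H) (t : 'I_T.+1) (i : node H t) a :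
  strategy_at X i 0 a = X (tagnat.Rank t i) a.
Proof. by rewrite !mxE. Qed.

Lemma claim_atE (v : claim R H) (t : 'I_T.+1) (i : node H t) :
  claim_at v i = v (tagnat.Rank t i) 0.
Proof. by rewrite /claim_at mxE. Qed.

Lemma continuous_entry m n (M : E -> 'M[R]_(m, n)) i j :
  continuous M -> continuous (fun z => M z i j).
Proof.
by move=> cM z; exact: (cvg_comp M _ (cM z) (@coord_continuous R m n i j (M z))).
Qed.

Lemma continuous_inner_prod (c : 'rV[R]_k.+1) (y : E -> 'rV[R]_k.+1) :
  (forall a, continuous (fun z => y z 0 a)) ->
  continuous (fun z => inner_prod c (y z)).
Proof.
move=> cy; apply: continuous_sum => a z.
by apply: cvgM; [exact: cvg_cst|exact: cy].
Qed.

Lemma continuous_strategy_at (X : E -> 'M[R]_(nb_inner H, k.+1))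
    (t : 'I_T.+1) (i : node H t) a :
  continuous X -> continuous (fun z => strategy_at (X z) i 0 a).
Proof.
move=> cX; under eq_fun do rewrite strategy_atE.
exact: continuous_entry.
Qed.

Lemma continuous_claim_at (v : E -> 'cV[R]_(nb_inner H))
    (t : 'I_T.+1) (i : node H t) :
  continuous v -> continuous (fun z => claim_at (v z) i).
Proof.
move=> cv; under eq_fun do rewrite claim_atE.
exact: continuous_entry.
Qed.

(** The claim perturbation moves together with the strategy, so what is needed is closedness of the
    graph of the feasible-set mapping. It holds because every constraint is a weak inequality
    between functions continuous in [z]. *)
Lemma closed_feasible (v : E -> 'cV[R]_(nb_inner H))
    (X : E -> 'M[R]_(nb_inner H, k.+1)) :
  continuous v -> continuous X -> closed [set z | feasible S G (v z) (X z)].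
Proof.
move=> cv cX.
have budget_cont (t : 'I_T.+1) (i : node H t) :
    continuous (fun z => claim_at G i + claim_at (v z) i).
  move=> z; apply: cvgD; first exact: cvg_cst.
  exact: continuous_claim_at.
rewrite (_ : [set z | _] =
   [set z | forall (t : 'I_T.+1) (i : node H t) (a : 'I_k.+1),
        0 <= strategy_at (X z) i 0 a] `&`
   ([set z | forall i : node H 0%N,
        inner_prod (S i) (strategy_at (X z) (t := ord0) i)
        <= claim_at G (t := ord0) i + claim_at (v z) (t := ord0) i] `&`
   [set z | forall (s : 'I_T) (i : node H s.+1),
        inner_prod (S i) (rebalancing (X z) i)
        <= claim_at G (t := lift ord0 s) i
           + claim_at (v z) (t := lift ord0 s) i])); last first.
  by apply/seteqP; split => z; [case|move=> [? []]].
apply: closedI; last apply: closedI.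
- do 3!apply: closed_forall => ?; apply: closed_le_continuous.
    by move=> z; exact: cvg_cst.
  exact: continuous_strategy_at.
- apply: closed_forall => i; apply: closed_le_continuous; last exact: budget_cont.
  by apply: continuous_inner_prod => a; exact: continuous_strategy_at.
- do 2!apply: closed_forall => ?; apply: closed_le_continuous;
    last exact: budget_cont.
  apply: continuous_inner_prod => a; rewrite /rebalancing.
  under eq_fun do rewrite mxE [X in _ + X]mxE.
  by move=> z; apply: cvgB; exact: continuous_strategy_at.
Qed.

End Continuity.

(** * The objective with its parameters among the variables *)

Section ParametrizedObjective.
Variables (R : realType) (T k : nat) (H : scenario_tree T).
Variables (S : prices R k H) (G : claim R H).

(** A point is [(p, theta, (u, v, X))]: [z.1.1] is the probability vector, [z.1.2] the penalty
    weight, and [z.2.1.1], [z.2.1.2], [z.2.2] are [u], [v], [X]. *)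
Local Notation point := ('rV[R]_(nb_terminal H) * R *
  ('rV[R]_(nb_terminal H) * 'cV[R]_(nb_inner H) * 'M[R]_(nb_inner H, k.+1)))%type.

Definition objective (z : point) : R :=
  - (\sum_(j < nb_terminal H)
      (z.1.1 0 j + z.2.1.1 0 j) * terminal_wealth S z.2.2 j)
  + 2^-1 * z.1.2 * \sum_(j < nb_terminal H) z.2.1.1 0 j ^+ 2.

Definition objective_dom : set point :=
  [set z : point | [/\ feasible S G z.2.1.2 z.2.2,
    (forall j, 0 <= (z.1.1 + z.2.1.1) 0 j) & (forall j, z.2.1.1 0 j <= 0)]].

Lemma f3E p theta x : f3 S G p theta x =
  ((objective (p, theta, x))%:E + iota_set R objective_dom (p, theta, x))%E.
Proof.
case: x => [[u v] X]; rewrite /f3 /iota_set /objective /objective_dom /=.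
case: (asboolP [/\ _, _ & _]) => [[hX hpu hu]|nD].
  by rewrite !asboolT //= !adde0 EFinD.
(* No term is [-oo], so one violated constraint already makes both sides [+oo]; only the case where
   all three hold remains, and it contradicts [nD]. *)
case: asboolP => hX; case: asboolP => hpu; case: asboolP => hu //.
by case: nD.
Qed.

Let cont_p : continuous (fun z : point => z.1.1).
Proof. by move=> z; exact: (cvg_comp fst fst cvg_fst cvg_fst). Qed.

Let cont_theta : continuous (fun z : point => z.1.2).
Proof. by move=> z; exact: (cvg_comp fst snd cvg_fst cvg_snd). Qed.

Let cont_u : continuous (fun z : point => z.2.1.1).
Proof.
move=> z.
exact: (cvg_comp _ fst (cvg_comp snd fst cvg_snd cvg_fst) cvg_fst).
Qed.

Let cont_v : continuous (fun z : point => z.2.1.2).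
Proof.
move=> z.
exact: (cvg_comp _ snd (cvg_comp snd fst cvg_snd cvg_fst) cvg_snd).
Qed.

Let cont_X : continuous (fun z : point => z.2.2).
Proof. by move=> z; exact: (cvg_comp snd snd cvg_snd cvg_snd). Qed.

Let cont_pj j : continuous (fun z : point => z.1.1 0 j).
Proof. exact: continuous_entry cont_p. Qed.

Let cont_uj j : continuous (fun z : point => z.2.1.1 0 j).
Proof. exact: continuous_entry cont_u. Qed.

Lemma continuous_objective : continuous objective.
Proof.
have cont_wealth j : continuous (fun z : point => terminal_wealth S z.2.2 j).
  by apply: continuous_inner_prod => a; exact: continuous_strategy_at.
move=> z; apply: cvgD.
  apply: cvgN; apply: continuous_sum => j {}z.
  by apply: cvgM; [apply: cvgD; [exact: cont_pj|exact: cont_uj]|exact: cont_wealth].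
apply: cvgM; first by apply: cvgM; [exact: cvg_cst|exact: cont_theta].
by apply: continuous_sum => j {}z; apply: cvgM; exact: cont_uj.
Qed.

Lemma closed_objective_dom : closed objective_dom.
Proof.
have cont0 : continuous (fun _ : point => 0 : R) by move=> z; exact: cvg_cst.
rewrite (_ : objective_dom =
   [set z : point | feasible S G z.2.1.2 z.2.2] `&`
   ([set z : point | forall j, 0 <= (z.1.1 + z.2.1.1) 0 j] `&`
    [set z : point | forall j, z.2.1.1 0 j <= 0])); last first.
  by apply/seteqP; split => z; [case|move=> [? []]].
apply: closedI; first exact: closed_feasible.
apply: closedI; apply: closed_forall => j; apply: closed_le_continuous => //.
under eq_fun do rewrite mxE.
by move=> z; apply: cvgD; [exact: cont_pj|exact: cont_uj].
Qed.

End ParametrizedObjective.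

(* Since [- p <= u], the entries satisfy [`|max u (- q) - u| <= `|p - q|]. *)
Lemma cvg_row_max (R : realType) (m : nat) (p u : 'rV[R]_m)
    (p_ : nat -> 'rV[R]_m) :
  p_ nu @[nu --> \oo] --> p -> (forall j, 0 <= (p + u) 0 j) ->
  \row_j Num.max (u 0 j) (- p_ nu 0 j) @[nu --> \oo] --> u.
Proof.
move=> /cvg_ballP cp pu; apply/cvg_ballP => e e0.
apply: filterS (cp e e0) => nu [_ pe]; split=> // i j.
rewrite ord1 !mxE; move: (pe 0 j) (pu j); rewrite mxE /ball /= => pej puj.
rewrite ltr_norml in pej; rewrite ltr_norml.
by case: (leP (u 0 j) (- p_ nu 0 j)) => upj; lra.
Qed.

Theorem proposition3p6 (R : realType) (T k : nat) (hT : (1 <= T)%N)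
  (hk : (1 <= k)%N) (H : scenario_tree T) (critical : {set node H T.+1})
  (S : prices R k H) (kappa : node H T.+1 -> 'I_k -> R) (G : claim R H)
  (p : 'rV[R]_(nb_terminal H)) (theta : R)
  (p_ : nat -> 'rV[R]_(nb_terminal H)) (theta_ : nat -> R)
  (hS : forall (t : nat) (i : node H t) (a : 'I_k.+1),
      (t <= T.+1)%N -> 0 < S t i 0 a)
  (hS0 : forall (t : nat) (i i' : node H t),
      (t <= T.+1)%N -> S t i 0 0 = S t i' 0 0)
  (hkappa : forall (j : node H T.+1) (a : 'I_k),
      j \in critical -> 0 < kappa j a)
  (hcritical : forall (j : node H T.+1) (a : 'I_k), j \in critical ->
      S T.+1 j 0 (lift ord0 a) = kappa j a * S T (parent H j) 0 (lift ord0 a))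
  (hp : simplex p)
  (hpcritical : forall j : node H T.+1, j \in critical -> p 0 j = 0)
  (hNA : arbitrage_free S p)
  (hG0 : forall i : node H 0%N, 0 < claim_at G (t := ord0) i)
  (hG : forall (s : 'I_T) (i : node H s.+1),
      claim_at G (t := lift ord0 s) i < 0)
  (htheta : 0 < theta)
  (hp_ : forall nu : nat, simplex (p_ nu))
  (htheta_ : forall nu : nat, 0 < theta_ nu)
  (cvg_p : p_ nu @[nu --> \oo] --> p)
  (cvg_theta : theta_ nu @[nu --> \oo] --> theta) :
  epi_converges (fun nu => f3 S G (p_ nu) (theta_ nu)) (f3 S G p theta).
Proof.
have cont := @continuous_objective R T k H.
move=> x; split=> [x_ cx|].
  rewrite f3E; under eq_fun => nu do rewrite f3E.
  (* The varying parameters are absorbed into one convergent sequence of points, on which a single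
     fixed function is evaluated. *)
  apply: (limn_einf_indicator (z_ := fun nu => (p_ nu, theta_ nu, x_ nu)) (cont _)
    (@closed_objective_dom R T k H S G)).
  exact: (cvg_pair (cvg_pair cvg_p cvg_theta) cx).
rewrite [f3 S G p theta x]f3E.
have [Dx|nDx] := asboolP (objective_dom S G (p, theta, x)); last first.
  (* Outside the domain the limit value is [+oo], so any sequence tending to [x] is a recovery
     sequence. *)
  exists (fun=> x); split; first exact: cvg_cst.
  by rewrite /iota_set asboolF // addey // leey.
rewrite /iota_set asboolT // adde0.
case: x Dx => [[u v] X] [/= hX hpu hu].
pose u_ nu : 'rV[R]_(nb_terminal H) := \row_j Num.max (u 0 j) (- p_ nu 0 j).
have cx : (u_ nu, v, X) @[nu --> \oo] --> (u, v, X).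
  have cu := cvg_row_max cvg_p hpu.
  exact: (cvg_pair (cvg_pair cu (cvg_cst v)) (cvg_cst X)).
(* Feasibility persists because [v] and [X] are kept. The maximum dominates [- p_ nu], which keeps
   the sum nonnegative; it is nonpositive because both [u] and [- p_ nu] are, the latter since
   [p_ nu] lies in the simplex. *)
have Dx_ nu : objective_dom S G (p_ nu, theta_ nu, (u_ nu, v, X)).
  split=> //= j; rewrite !mxE.
    by rewrite addrC -lerBlDr sub0r le_max lexx orbT.
  by rewrite ge_max hu oppr_le0 (hp_ nu).1.
exists (fun nu => (u_ nu, v, X)); split => //.
under eq_fun => nu do rewrite f3E /iota_set asboolT // adde0.
(* With the indicators zero along the whole sequence, continuity of the finite part gives
   convergence of the values, so the upper limit equals the limit value. *)
have c : (objective S (p_ nu, theta_ nu, (u_ nu, v, X)))%:E @[nu --> \oo] -->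
    (objective S (p, theta, (u, v, X)))%:E.
  apply: cvg_EFin; first exact: nearW.
  exact: (continuous_cvg _ (cont S (p, theta, (u, v, X)))
    (cvg_pair (cvg_pair cvg_p cvg_theta) cx)).
by rewrite (cvg_limn_einf_sup c).2.
Qed.
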